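(* Let $X\subset\mathbb{P}^1\times\mathbb{P}^1$ be a nonempty finite set of points. Let $m$ be the maximum number of points of $X$ on a single horizontal ruling, and let $n$ be the maximum number of points of $X$ on a single vertical ruling. If $|X|<mn$, and there is at least one point of $X$ that lies both on a horizontal ruling containing $m$ points of $X$ and on a vertical ruling containing $n$ points of $X$, then $X$ is not a virtual complete intersection.
   Context: Let $\Bbbk$ be an algebraically closed field; $\mathbb{P}^1\times\mathbb{P}^1$ is over $\Bbbk$, with projections $\pi_1,\pi_2$ to the first and second factor. A vertical ruling is a fiber of $\pi_1$ and a horizontal ruling is a fiber of $\pi_2$. The Cox ring is $S=\Bbbk[x_0,x_1,y_0,y_1]$, $\mathbb{Z}^2$-graded with $\deg x_i=(1,0)$ and $\deg y_i=(0,1)$, and $B=\langle x_0,x_1\rangle\cap\langle y_0,y_1\rangle$ is the irrelevant ideal. A set of points means a reduced zero-dimensional subscheme $X$ of $\mathbb{P}^1\times\mathbb{P}^1$; $I_X\subset S$ is the $B$-saturated bihomogeneous ideal of polynomials vanishing on $X$. A virtual resolution of $S/I$ ($I$ a bihomogeneous ideal) is a $\mathbb{Z}^2$-graded complex of free $S$-modules $F_\bullet=[F_0\xleftarrow{\varphi_1}F_1\xleftarrow{\varphi_2}F_2\leftarrow\cdots]$ such that for every $i\ge 1$ the annihilator of $H_i(F_\bullet)$ contains $B^\ell$ for some $\ell>0$, and the sheaves on $\mathbb{P}^1\times\mathbb{P}^1$ associated to $S/I$ and $\operatorname{coker}(\varphi_1)$ are isomorphic. The set $X$ is a virtual complete intersection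 (VCI) if $S/I_X$ has a virtual resolution that is the Koszul complex $K(f,g)$ of two bihomogeneous forms $f,g\in S$. *)

(* Defs.v *)
From HB Require Import structures.
From mathcomp Require Import all_boot all_order all_algebra.
From mathcomp Require Import finmap.
From mathcomp Require Export mpoly.

Set Implicit Arguments.
Unset Strict Implicit.
Unset Printing Implicit Defensive.

Import GRing.Theory.
Local Open Scope ring_scope.

(* A point of P^1 is a line through the origin of k^2; its homogeneous        *)
(* coordinates are the nonzero vectors of that line.                          *)
Definition P1 (k : fieldType) := {L : {vspace 'rV[k]_2} | \dim L == 1%N}.

Section CoxRing.
Variable k : fieldType.
Local Notation S := {mpoly k[2 + 2]}.

(* The first block of two variables of the Cox ring {mpoly k[2 + 2]} of       *)
(* P^1 x P^1 is x_0, x_1, the second one is y_0, y_1.                         *)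
Definition x_ (i : 'I_2) : S := 'X_(lshift 2 i).
Definition y_ (j : 'I_2) : S := 'X_(rshift 2 j).

Definition bidegm (e : 'X_{1..2 + 2}) : int * int :=
  (((\sum_(i < 2) e (lshift 2 i))%N)%:Z, ((\sum_(j < 2) e (rshift 2 j))%N)%:Z).

(* p is a bihomogeneous form of bidegree d; 0 is a form of every bidegree,    *)
(* and the only one when d has a negative component.                          *)
Definition bihomog (d : int * int) (p : S) : bool :=
  all (fun e => bidegm e == d) (msupp p).

Definition gen2 (a b : S) (p : S) : Prop := exists s t : S, p = s * a + t * b.

Definition irrelevant (p : S) : Prop :=
  gen2 (x_ 0) (x_ 1) p /\ gen2 (y_ 0) (y_ 1) p.

Definition ideal_mul (I J : S -> Prop) (p : S) : Prop :=
  exists s : seq (S * S),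
    (forall c, c \in s -> I c.1 /\ J c.2) /\ p = \sum_(c <- s) c.1 * c.2.

Fixpoint ideal_exp (I : S -> Prop) (l : nat) : S -> Prop :=
  if l is l'.+1 then ideal_mul I (ideal_exp I l') else fun _ => True.

End CoxRing.

Section Sheaves.
Variable k : fieldType.
Local Notation S := {mpoly k[2 + 2]}.

(* The graded S-module F / N, where F is free with basis elements e_j of      *)
(* bidegree gdeg j and N = gsub is a graded submodule of F.                   *)
Record gmod := GMod {
  grank : nat;
  gdeg : 'I_grank -> int * int;
  gsub : 'rV[S]_grank -> Prop }.

Definition ghomog (M : gmod) (d : int * int) (v : 'rV[S]_(grank M)) : Prop :=
  forall j, bihomog (d - gdeg j) (v 0 j).

(* For h a form of bidegree d in the irrelevant ideal, D(h) = {h != 0} is     *)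
(* affine, and the sections over D(h) of the sheaf associated to M form the   *)
(* degree 0 part of the localization M_h.  The pair (v, a) stands for the     *)
(* fraction v / h ^ a.                                                        *)
Definition frac (M : gmod) := ('rV[S]_(grank M) * nat)%type.

Definition is_section (M : gmod) (d : int * int) (s : frac M) : Prop :=
  ghomog (d *+ s.2) s.1.

Definition frac_eq (M : gmod) (h : S) (s t : frac M) : Prop :=
  exists c : nat, gsub (h ^+ c *: (h ^+ t.2 *: s.1 - h ^+ s.2 *: t.1)).

Definition frac_add (M : gmod) (h : S) (s t : frac M) : frac M :=
  (h ^+ t.2 *: s.1 + h ^+ s.2 *: t.1, (s.2 + t.2)%N).

(* The action of the regular function p / h ^ b. *)
Definition frac_scale (M : gmod) (p : S) (b : nat) (s : frac M) : frac M :=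
  (p *: s.1, (b + s.2)%N).

(* Restriction from D(h) to D(h * g). *)
Definition frac_res (M : gmod) (g : S) (s : frac M) : frac M :=
  (g ^+ s.2 *: s.1, s.2).

(* Morphisms of O-modules between the associated sheaves, given on the basis  *)
(* of open sets D(h) and on representatives.  Every inclusion D(h') <= D(h)   *)
(* is, up to replacing h' by a power, of the form D(h * g) <= D(h).           *)
Record sheaf_mor (M N : gmod) (phi : S -> frac M -> frac N) : Prop := {
  mor_section : forall h d, irrelevant h -> bihomog d h ->
    forall s, is_section d s -> is_section d (phi h s);
  mor_eq : forall h d, irrelevant h -> bihomog d h ->
    forall s t, is_section d s -> is_section d t ->
    frac_eq h s t -> frac_eq h (phi h s) (phi h t);
  mor_add : forall h d, irrelevant h -> bihomog d h ->
    forall s t, is_section d s -> is_section d t ->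
    frac_eq h (phi h (frac_add h s t)) (frac_add h (phi h s) (phi h t));
  mor_scale : forall h d, irrelevant h -> bihomog d h ->
    forall p b s, bihomog (d *+ b) p -> is_section d s ->
    frac_eq h (phi h (frac_scale p b s)) (frac_scale p b (phi h s));
  mor_res : forall h d, irrelevant h -> bihomog d h ->
    forall g e s, bihomog e g -> is_section d s ->
    frac_eq (h * g) (phi (h * g) (frac_res g s)) (frac_res g (phi h s)) }.

Definition sheaf_iso (M N : gmod) : Prop :=
  exists (phi : S -> frac M -> frac N) (psi : S -> frac N -> frac M),
    [/\ sheaf_mor phi, sheaf_mor psi,
        forall h d, irrelevant h -> bihomog d h ->
          forall s, is_section d s -> frac_eq h (psi h (phi h s)) s
      & forall h d, irrelevant h -> bihomog d h ->
          forall t, is_section d t -> frac_eq h (phi h (psi h t)) t].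

End Sheaves.

Section VirtualResolutions.
Variable k : fieldType.
Local Notation S := {mpoly k[2 + 2]}.

(* A bigraded complex F_0 <- F_1 <- ... of free modules of finite rank, F_i   *)
(* having its basis in bidegrees cdeg i.  Elements of F_i are row vectors,    *)
(* and phi_(i+1) : F_(i+1) -> F_i is v |-> v *m cdiff i.                      *)
Record gcomplex := GComplex {
  crank : nat -> nat;
  cdeg : forall i, 'I_(crank i) -> int * int;
  cdiff : forall i, 'M[S]_(crank i.+1, crank i);
  cdiff_homog : forall i (a : 'I_(crank i.+1)) (b : 'I_(crank i)),
    bihomog (cdeg a - cdeg b) (cdiff i a b);
  cdiff_comp : forall i, cdiff i.+1 *m cdiff i = 0 }.

Definition coker1 (F : gcomplex) : gmod k :=
  GMod (@cdeg F 0) (fun v => exists w, v = w *m cdiff F 0).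

Definition quot_ring (I : S -> Prop) : gmod k :=
  GMod (fun _ : 'I_1 => 0) (fun v => I (v 0 0)).

(* The annihilator of H_(i+1)(F) = ker phi_(i+1) / im phi_(i+2). *)
Definition homology_ann (F : gcomplex) (i : nat) (b : S) : Prop :=
  forall v : 'rV[S]_(crank F i.+1), v *m cdiff F i = 0 ->
    exists w : 'rV[S]_(crank F i.+2), b *: v = w *m cdiff F i.+1.

Definition virtual_resolution (I : S -> Prop) (F : gcomplex) : Prop :=
  (forall i, exists2 l, (0 < l)%N &
     forall b, ideal_exp (@irrelevant k) l b -> homology_ann F i b)
  /\ sheaf_iso (quot_ring I) (coker1 F).

Definition koszul_rank (i : nat) : nat :=
  match i with 0 => 1 | 1 => 2 | 2 => 1 | _ => 0 end.

Definition koszul_deg (df dg : int * int) (i : nat) :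
    'I_(koszul_rank i) -> int * int :=
  match i return 'I_(koszul_rank i) -> int * int with
  | 0 => fun _ => 0
  | 1 => fun a => if a == 0 then df else dg
  | 2 => fun _ => df + dg
  | _ => fun _ => 0
  end.

Definition koszul_diff (f g : S) (i : nat) :
    'M[S]_(koszul_rank i.+1, koszul_rank i) :=
  match i return 'M[S]_(koszul_rank i.+1, koszul_rank i) with
  | 0 => \matrix_(a, _) (if a == 0 then f else g)
  | 1 => \matrix_(_, b) (if b == 0 then - g else f)
  | _ => 0
  end.

Lemma koszul_homog (f g : S) (df dg : int * int) :
  bihomog df f -> bihomog dg g ->
  forall i (a : 'I_(koszul_rank i.+1)) (b : 'I_(koszul_rank i)),
    bihomog (koszul_deg df dg a - koszul_deg df dg b) (koszul_diff f g i a b).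
Proof.
move=> hf hg [|[|[|i]]] a b /=; rewrite !mxE.
- by rewrite subr0; case: ifP.
- case: ifP => _; last by rewrite addrK.
  by rewrite [df + dg]addrC addrK /bihomog (perm_all _ (msuppN g)).
- by case: a.
- by case: a.
Qed.

Lemma koszul_comp (f g : S) i :
  koszul_diff f g i.+1 *m koszul_diff f g i = 0.
Proof.
case: i => [|[|i]] /=; apply/matrixP => a b; rewrite ?mul0mx ?mxE //.
by rewrite !big_ord_recl big_ord0 !mxE /= addr0 mulrC mulrN addrC subrr.
Qed.

Definition koszul (f g : S) (df dg : int * int)
    (hf : bihomog df f) (hg : bihomog dg g) : gcomplex :=
  GComplex (koszul_homog hf hg) (koszul_comp f g).

End VirtualResolutions.

Section Points.
Variable k : fieldType.
Local Notation S := {mpoly k[2 + 2]}.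

(* The polynomials that vanish at all homogeneous coordinates of all points   *)
(* of X.  Over an infinite field this ideal is bihomogeneous.                 *)
Definition vanishing_ideal (X : {fset P1 k * P1 k}) (p : S) : Prop :=
  forall P, P \in X -> forall u v : 'rV[k]_2,
    u \in val P.1 -> u != 0 -> v \in val P.2 -> v != 0 ->
    p.@[fun i => row_mx u v 0 i] = 0.

Definition virtual_complete_intersection (X : {fset P1 k * P1 k}) : Prop :=
  exists (f g : S) (df dg : int * int)
         (hf : bihomog df f) (hg : bihomog dg g),
    virtual_resolution (vanishing_ideal X) (koszul hf hg).

Definition on_vertical (X : {fset P1 k * P1 k}) (a : P1 k) : nat :=
  #|` [fset P in X | P.1 == a]%fset|.

Definition on_horizontal (X : {fset P1 k * P1 k}) (b : P1 k) : nat :=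
  #|` [fset P in X | P.2 == b]%fset|.

End Points.

Definition is_max (T : Type) (c : T -> nat) (m : nat) : Prop :=
  (forall t, c t <= m)%N /\ exists t, c t = m.

(* Main.v *)
Require Import Defs.
From HB Require Import structures.
From mathcomp Require Import all_boot all_order all_algebra.
From mathcomp Require Import finmap.
From mathcomp Require Import ring zify.

(* Let (a, b) and (c, d) be the bidegrees of f and g.  The isomorphism of       *)
(* sheaves makes (f, g) locally equal to the ideal of X.  From the Koszul       *)
(* complex, H^0(I_X(c-1, b-1)) = 0: this vanishing is obtained by hand in an    *)
(* affine chart whose two rulings at infinity avoid X, by lowering the degrees  *)
(* of u and v in p = u f + v g with trivial syzygies.  Hence the bc monomials   *)
(* of bidegree at most (c-1, b-1) are independent on X, so bc <= |X|, and       *)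
(* ad <= |X| by symmetry.                                                       *)
(*   Let P be the point on a horizontal ruling H with m points and a vertical   *)
(* ruling V with n points.  A generator that does not vanish on H has           *)
(* x-degree >= m, and one that does not vanish on V has y-degree >= n.  The two *)
(* generators do not both vanish on H, nor on V, since X is finite, and neither *)
(* vanishes on both H and V, since it would be singular at P.  In every case    *)
(* mn <= bc or mn <= ad.                                                        *)

(** The isomorphism of sheaves enters through annihilators ([sheaf_iso_annihilator]): for [h] in B,
    a form lying in one of the ideals I_X and (f, g), of bidegree a multiple of that of [h], lies in
    the other after multiplication by a power of [h]. The map [dehom] sends the linear forms
    defining the rulings at infinity to 1. With F and G the images of f and g, it follows that every
    polynomial vanishing on the affine points lies in (F, G) ([affine_ideal]). The same comparison
    shows that f and g have no common zero outside X ([common_zero]). Applied at infinity, this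
    makes the top coefficients of F and G coprime in each variable, as the lowering of degrees
    requires. The bound bc <= |X| is then [bidegree_product_le]. The degree bounds on the two
    rulings are [horizontal_ruling] and [vertical_ruling], the singularity argument is
    [not_both_rulings], and [ruling_cases] combines them. *)

Set Implicit Arguments.
Unset Strict Implicit.
Unset Printing Implicit Defensive.

Import GRing.Theory.
Local Open Scope ring_scope.

(** * Syzygies and degree bounds for two bivariate polynomials *)

Section TopCoef.
Variable R : comNzRingType.
Implicit Types u v p f g : {poly R}.

(* If [N < b] then [u = 0], so that the truncated [N - b] is harmless.          *)
Lemma coefM_top f u (b N : nat) :
  (size f <= b.+1)%N -> (forall j, (N < j + b)%N -> u`_j = 0) ->
  (u * f)`_N = u`_(N - b) * f`_b.
Proof.
move=> sf hu; have [ltN|leN] := ltnP N b.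
  have -> : u = 0 by apply/polyP => j; rewrite coef0 hu // ltn_addl.
  by rewrite mul0r !coef0 mul0r.
have hN : (N - b < N.+1)%N by rewrite ltnS leq_subr.
rewrite coefM (bigD1 (Ordinal hN)) //= subKn // big1 ?addr0 // => -[i /= hi] ne.
have {}ne : i <> (N - b)%N by move=> e; case/eqP: ne; apply: val_inj.
have [lt|le] := ltnP (N - b) i; first by rewrite hu ?mul0r //; lia.
by rewrite [f`_ _]nth_default ?mulr0 //; apply: leq_trans sf _; lia.
Qed.

(** The Koszul complex of a unimodular pair is exact; the Bezout coefficients give the contracting
    homotopy, hence the witness [B * u0 - A * v0]. *)
Lemma syzygy_trivial (f0 g0 A B u0 v0 : R) :
  A * f0 + B * g0 = 1 -> u0 * f0 + v0 * g0 = 0 ->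
  exists w, u0 = w * g0 /\ v0 = - (w * f0).
Proof.
move=> hAB h; exists (B * u0 - A * v0); split.
  by rewrite -[LHS]mulr1 -hAB -[RHS]addr0 -(mulr0 A) -h; ring.
by rewrite -[LHS]mulr1 -hAB -[RHS]addr0 -(mulr0 B) -h; ring.
Qed.

(* While the degrees of [u * f] and [v * g] exceed that of their sum, their     *)
(* leading coefficients form a syzygy of the coprime [f`_a] and [g`_c], which   *)
(* is trivial and can be subtracted.                                            *)
Lemma comb_size_reduce f g u v (a c : nat) (A B : R) :
  (size f <= a.+1)%N -> (size g <= c.+1)%N -> A * f`_a + B * g`_c = 1 ->
  (size (u * f + v * g)%R <= a + c)%N ->
  exists u' v', [/\ u * f + v * g = u' * f + v' * g,
    (size u' <= c)%N & (size v' <= a)%N].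
Proof.
move=> sf sg hAB; move Ep: (u * f + v * g) => p sp.
have [N hu hv] : exists2 N, forall j, (N + (a + c) <= j + a)%N -> u`_j = 0 &
                            forall j, (N + (a + c) <= j + c)%N -> v`_j = 0.
  exists (size u + size v)%N => j; set nu := size u; set nv := size v => h.
    by rewrite nth_default // -/nu; lia.
  by rewrite nth_default // -/nv; lia.
elim: N u v Ep hu hv => [|N IH] u v Ep hu hv.
  exists u, v; split=> //; apply/leq_sizeP => j hj.
    by apply: hu; lia.
  by apply: hv; lia.
set M := (N + (a + c))%N.
have : u`_(M - a) * f`_a + v`_(M - c) * g`_c = 0.
  rewrite -!coefM_top //.
  by rewrite -coefD Ep nth_default // (leq_trans sp) // /M leq_addl.
case/(syzygy_trivial hAB) => w [hu0 hv0].
have e : (u - w%:P * ('X^N * g)) * f + (v + w%:P * ('X^N * f)) * g = p.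
  by rewrite -Ep; ring.
apply: IH e _ _ => // j hj; rewrite ?coefB ?coefD coefCM coefXnM.
  rewrite ifF; last by lia.
  have [E|ne] := eqVneq (j + a)%N M.
    have -> : j = (M - a)%N by lia.
    have -> : (M - a - N = c)%N by rewrite /M; lia.
    by rewrite hu0 subrr.
  rewrite hu; last by rewrite /M in ne; lia.
  by rewrite nth_default ?mulr0 ?subr0 //; apply: leq_trans sg _; rewrite /M in ne; lia.
rewrite ifF; last by lia.
have [E|ne] := eqVneq (j + c)%N M.
  have -> : j = (M - c)%N by lia.
  have -> : (M - c - N = a)%N by rewrite /M; lia.
  by rewrite hv0 addNr.
rewrite hv; last by rewrite /M in ne; lia.
by rewrite nth_default ?mulr0 ?addr0 //; apply: leq_trans sf _; rewrite /M in ne; lia.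
Qed.

(** As long as [u] or [v] may reach a top degree, their coefficients there satisfy a relation with
    [f]_b[and]g[_d]. Since [syz] allows only the zero relation, the degrees descend until nothing is
    left of [u]. *)
Lemma comb_small_eq0 f g u v (b d : nat) :
  (size f <= b.+1)%N -> (size g <= d.+1)%N ->
  (forall i j, u`_i * f`_b + v`_j * g`_d = 0 -> u`_i = 0 /\ v`_j = 0) ->
  (size (u * f + v * g)%R <= b)%N -> u = 0.
Proof.
move=> sf sg syz sp.
have [N hu hv] : exists2 N, forall j, (N + b <= j + b)%N -> u`_j = 0 &
                            forall j, (N + b <= j + d)%N -> v`_j = 0.
  exists (size u + size v + d)%N => j; set nu := size u; set nv := size v => h.
    by rewrite nth_default // -/nu; lia.
  by rewrite nth_default // -/nv; lia.
elim: N hu hv => [|N IH] hu hv.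
  by apply/polyP => j; rewrite coef0 hu // add0n leq_addl.
have [hu0 hv0] : u`_(N + b - b) = 0 /\ v`_(N + b - d) = 0.
  apply: syz; rewrite -!coefM_top //.
  by rewrite -coefD nth_default // (leq_trans sp) // leq_addl.
apply: IH => j hj.
  have [E|ne] := eqVneq (N + b)%N (j + b)%N; last by apply: hu; lia.
  by rewrite E addnK in hu0.
have [E|ne] := eqVneq (N + b)%N (j + d)%N; last by apply: hv; lia.
by rewrite E addnK in hv0.
Qed.

End TopCoef.

Section Bivariate.
Variable k : fieldType.
Implicit Types F G u v p : {poly {poly k}}.

Lemma coprimep_Bezout1 (p q : {poly k}) :
  coprimep p q -> exists A B, A * p + B * q = 1.
Proof. by move/Bezout_eq1_coprimepP => [[A B] /= h]; exists A, B. Qed.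

(* With [F], [G] of bidegrees (a, b), (c, d) and without common zero at         *)
(* infinity, this is H^0(I(c-1, b-1)) = 0 for the ideal sheaf I = (F, G).       *)
Lemma comb_bisize_eq0 F G u v (a b c d : nat) :
  (size F <= b.+1)%N -> (size (swapXY F) <= a.+1)%N ->
  (size G <= d.+1)%N -> (size (swapXY G) <= c.+1)%N ->
  coprimep (swapXY F)`_a (swapXY G)`_c -> coprimep F`_b G`_d ->
  (F`_b`_a != 0) || (G`_d`_c != 0) -> (swapXY G)`_c != 0 ->
  (size (u * F + v * G)%R <= b)%N ->
  (size (swapXY (u * F + v * G)%R) <= c)%N ->
  u * F + v * G = 0.
Proof.
move=> sF sF' sG sG' /coprimep_Bezout1[A' [B' hAB']] /coprimep_Bezout1[A [B hAB]].
move=> corner nzG sp sp'.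
have Esw : swapXY (u * F + v * G) =
    swapXY u * swapXY F + swapXY v * swapXY G by rewrite rmorphD !rmorphM.
(* First lower the degrees in s, the outer variable after [swapXY]: [u'] gets s-degree below c and
   [v'] below a. *)
have [|u' [v' [Ep su' sv']]] :=
    @comb_size_reduce _ _ _ (swapXY u) (swapXY v) _ _ _ _ sF' sG' hAB'.
  by rewrite -Esw (leq_trans sp') // leq_addl.
have Ep2 : u * F + v * G = swapXY u' * F + swapXY v' * G.
  by apply: (can_inj (@swapXYK _)); rewrite Esw Ep rmorphD !rmorphM /= !swapXYK.
(* Now compare top coefficients in t. A nonzero syzygy is a multiple [w] of (G_d, -F_b); the bounds
   on s-degrees would then force both corner coefficients to vanish. *)
have U0 : swapXY u' = 0.
  apply: (@comb_small_eq0 _ F G _ (swapXY v') b d) => //; last by rewrite -Ep2.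
  move=> i j h; have [w [hu hv]] := syzygy_trivial hAB h.
  suff w0 : w = 0 by rewrite hu hv w0 !mul0r oppr0.
  apply: contraTeq corner => nzw; rewrite negb_or !negbK; apply/andP; split.
    apply/eqP/nth_default; apply: (@leq_trans (size (swapXY v')`_j)).
      have [->|nz] := eqVneq F`_b 0; first by rewrite size_poly0.
      rewrite hv size_polyN size_mul //.
      by move: nzw; rewrite -size_poly_gt0; case: (size w) => // n _; rewrite addSn leq_addl.
    by apply/leq_sizeP => l hl; rewrite coef_swapXY [v'`_l]nth_default ?coef0 // (leq_trans sv').
  apply/eqP/nth_default; apply: (@leq_trans (size (swapXY u')`_i)).
    have [->|nz] := eqVneq G`_d 0; first by rewrite size_poly0.
    rewrite hu size_mul //.
    by move: nzw; rewrite -size_poly_gt0; case: (size w) => // n _; rewrite addSn leq_addl.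
  by apply/leq_sizeP => l hl; rewrite coef_swapXY [u'`_l]nth_default ?coef0 // (leq_trans su').
have u'0 : u' = 0 by apply/eqP; rewrite -swapXY_eq0 U0.
(* Only a multiple of [G] remains, and [G] has s-degree exactly c, while the sum has s-degree below
   c. *)
rewrite Ep2 U0 mul0r add0r; apply/eqP; rewrite mulf_eq0; apply/orP; left.
apply: contraTT sp' => nzV; rewrite Esw Ep u'0 mul0r add0r -ltnNge.
have nzsG : swapXY G != 0 by apply: contraNneq nzG => ->; rewrite coef0.
rewrite size_mul //; last by rewrite -swapXY_eq0.
have : (c < size (swapXY G))%N by rewrite ltnNge; apply: contra nzG => /leq_sizeP ->.
move: nzV; rewrite swapXY_eq0 -size_poly_gt0.
by case: (size v') => // n _; rewrite addSn /= => /leq_trans-> //; rewrite leq_addl.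
Qed.

End Bivariate.

(** * Finite sets of points in the affine plane *)

Section PlanarPoints.
Variable k : fieldType.
Implicit Types (F G p : {poly {poly k}}) (L : seq (k * k)).

Definition vanishes_on L p := forall z, z \in L -> p.[z.2, z.1] = 0.

(** There are more monomials s^i t^j with i < c and j < b than points, so some combination vanishes
    at all of them. Row [r] of the evaluation matrix encodes the monomial with j = r %/ c and i = r
    %% c. *)
Lemma interpolation_kernel L (b c : nat) : (size L < b * c)%N ->
  exists p, [/\ p != 0, vanishes_on L p, (size p <= b)%N &
                (size (swapXY p) <= c)%N].
Proof.
move=> ltL; have c_gt0 : (0 < c)%N by rewrite lt0n; apply: contraTneq ltL => ->; rewrite muln0.
pose A := \matrix_(r < b * c, l < size L)
  ((nth (0, 0) L l).2 ^+ (r %/ c) * (nth (0, 0) L l).1 ^+ (r %% c)).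
have : kermx A != 0.
  rewrite -mxrank_eq0 mxrank_ker subn_eq0 -ltnNge.
  exact: leq_ltn_trans (rank_leq_col A) ltL.
case/rowV0Pn => w /sub_kermxP wA nzw.
pose p : {poly {poly k}} :=
  \sum_(r < b * c) (w 0 r *: 'X^(r %% c))%:P * 'X^(r %/ c).
have coefp i j : p`_j`_i = \sum_(r < b * c | (r %/ c == j)%N && (r %% c == i)%N) w 0 r.
  rewrite /p !coef_sum [RHS]big_mkcond /=; apply: eq_bigr => r _.
  rewrite coefCM coefXn eq_sym; case: eqP => _ /=; last by rewrite mulr0 coef0.
  by rewrite mulr1 coefZ coefXn eq_sym; case: eqP => _; rewrite ?mulr1 ?mulr0.
exists p; split.
- apply: contraNneq nzw => p0; apply/eqP/rowP => r; rewrite [RHS]mxE.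
  have := coefp (r %% c)%N (r %/ c)%N; rewrite p0 !coef0 (big_pred1 r) // => r'.
  apply/andP/eqP => [[/eqP e1 /eqP e2]|-> //].
  by apply: val_inj; rewrite /= (divn_eq r c) (divn_eq r' c) e1 e2.
- move=> z /(nthP (0, 0))[l ltl zE].
  have /rowP/(_ (Ordinal ltl)) := wA; rewrite !mxE => h; rewrite -[RHS]h.
  rewrite /p !horner_sum; apply: eq_bigr => r _; rewrite mxE /= zE.
  by rewrite !hornerE /= mulrAC.
- apply/leq_sizeP => j lej; apply/polyP => i; rewrite coefp coef0 big1 // => r.
  by case/andP => /eqP e _; move: lej; rewrite -e leqNgt ltn_divLR // ltn_ord.
- apply/leq_sizeP => j lej; apply/polyP => i.
  rewrite coef_swapXY coefp coef0 big1 // => r.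
  by case/andP => _ /eqP e; move: lej; rewrite -e leqNgt ltn_mod c_gt0.
Qed.

Lemma bidegree_product_le L F G (a b c d : nat) :
  (forall p, vanishes_on L p -> exists u v, p = u * F + v * G) ->
  (size F <= b.+1)%N -> (size (swapXY F) <= a.+1)%N ->
  (size G <= d.+1)%N -> (size (swapXY G) <= c.+1)%N ->
  coprimep (swapXY F)`_a (swapXY G)`_c -> coprimep F`_b G`_d ->
  (F`_b`_a != 0) || (G`_d`_c != 0) ->
  (b * c <= size L)%N.
Proof.
move=> ideal sF sF' sG sG' cop_s cop_t corner.
(* If the top s-coefficient of [G] is 0, coprimality makes that of [F] a nonzero constant, and the
   corner condition leaves only b = 0. *)
have [G0|nzG] := eqVneq (swapXY G)`_c 0.
  move: corner; rewrite -(coef_swapXY F) -(coef_swapXY G) G0 coef0 eqxx orbF => nzF.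
  move: cop_s; rewrite G0 coprimep0 -size_poly_eq1 => /eqP szF.
  have : (b < 1)%N by rewrite ltnNge; apply: contra nzF => le1; rewrite nth_default ?szF.
  by rewrite ltnS leqn0 => /eqP->.
rewrite leqNgt; apply/negP => /interpolation_kernel[p [nzp vanp sp sp']].
have [u [v Ep]] := ideal p vanp.
by case/eqP: nzp; rewrite Ep; apply: (comb_bisize_eq0 sF sF' sG sG'); rewrite -?Ep.
Qed.

(* Otherwise [F] is singular at [z], and the ideal [(F, G)] is not the maximal  *)
(* ideal locally at [z].                                                        *)
Lemma not_both_rulings L F G z :
  z \in L -> vanishes_on L G ->
  (forall p, vanishes_on L p -> exists u v, p = u * F + v * G) ->
  F.[z.2%:P] = 0 -> (swapXY F).[z.1%:P] = 0 -> False.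
Proof.
case: z => s t zL /(_ _ zL) /= Gz ideal Ft Fs.
pose X1 (x : k) : {poly {poly k}} := ('X - x%:P)%:P.
pose X2 (y : k) : {poly {poly k}} := 'X - (y%:P)%:P.
have X1E x z : (X1 x).[z.2, z.1] = z.1 - x by rewrite /X1 !hornerE.
have X2E y z : (X2 y).[z.2, z.1] = z.2 - y by rewrite /X2 !hornerE.
(* [E] vanishes at the other points of [L] but not at (s, t), so it isolates the local ideal at that
   point. *)
pose E := \prod_(z <- L | z != (s, t)) (if z.1 != s then X1 z.1 else X2 z.2).
have Ez : E.[t, s] != 0.
  rewrite /E !horner_prod prodf_seq_neq0; apply/allP => -[s' t'] _ /=.
  apply/implyP; rewrite xpair_eqE negb_and => ne.
  case: ifP ne => /= [ne _|_ ne].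
    by rewrite (X1E s' (s, t)) subr_eq0 eq_sym.
  by rewrite (X2E t' (s, t)) subr_eq0 eq_sym.
have vanE p : p.[t, s] = 0 -> vanishes_on L (p * E).
  move=> p0 z zL'; rewrite !hornerM; have [-> /=|ne] := eqVneq z (s, t).
    by rewrite p0 mul0r.
  apply/eqP; rewrite mulf_eq0; apply/orP; right.
  rewrite /E !horner_prod prodf_seq_eq0; apply/hasP; exists z => //=.
  by rewrite ne /=; case: ifP => _; rewrite ?X1E ?X2E subrr.
have [|u1 [v1 E1]] := ideal (X1 s * E).
  by apply: vanE; rewrite (X1E s (s, t)) subrr.
have [|u2 [v2 E2]] := ideal (X2 t * E).
  by apply: vanE; rewrite (X2E t (s, t)) subrr.
(* Otherwise every element of (F, G), in particular [X2 t * E], would vanish on the whole vertical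
   ruling through the point. *)
have Gs : (swapXY G).[s%:P] != 0.
  apply: contraTneq isT => Gs.
  have := congr1 (fun p => (swapXY p).[s%:P]) E2.
  rewrite rmorphD !rmorphM /= !(hornerD, hornerM) Fs Gs !mulr0 addr0 => /eqP.
  rewrite mulf_eq0 => /orP[] /eqP h.
    have /eqP := congr1 (fun p : {poly k} => p.[t + 1]) h.
    by rewrite horner2_swapXY (X2E t (s, t + 1)) horner0 addrC addKr oner_eq0.
  by move: Ez; rewrite -horner2_swapXY h horner0 eqxx.
have v1s : (swapXY v1).[s%:P] = 0.
  have := congr1 (fun p => (swapXY p).[s%:P]) E1.
  rewrite rmorphD !rmorphM /= !(hornerD, hornerM) Fs mulr0 add0r.
  have -> : (swapXY (X1 s)).[s%:P] = 0.
    by rewrite /X1 swapXY_polyC rmorphB /= map_polyX map_polyC /= !hornerE subrr.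
  by rewrite mul0r => /esym/eqP; rewrite mulf_eq0 (negPf Gs) orbF => /eqP.
(* On the horizontal ruling, ('X - s) * E equals [v1 * G], and both [v1] and [G] vanish at s. Thus
   [E] would vanish there too. *)
have := congr1 (fun p : {poly {poly k}} => p.[t%:P]) E1.
rewrite !(hornerD, hornerM) Ft mulr0 add0r /X1 hornerC.
have /factor_theorem[q ->] : root v1.[t%:P] s.
  by rewrite /root -horner2_swapXY v1s horner0.
have /factor_theorem[r ->] : root G.[t%:P] s by rewrite /root Gz.
rewrite mulrC => e; have : E.[t%:P] = q * r * ('X - s%:P).
  by apply: (@mulIf _ ('X - s%:P)); rewrite ?polyXsubC_eq0 // e; ring.
by move=> e'; move: Ez; rewrite e' !hornerE subrr mulr0 eqxx.
Qed.

End PlanarPoints.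

(** * Bihomogeneous forms and isomorphisms of sheaves *)

Section Bihomogeneous.
Variable k : fieldType.
Local Notation S := {mpoly k[2 + 2]}.
Implicit Types (p q : S) (d e : int * int).

Lemma bihomogP d p : reflect (forall m, m \in msupp p -> bidegm m = d) (bihomog d p).
Proof. by apply: (iffP allP) => h m /h /eqP. Qed.

Lemma bidegmD (m n : 'X_{1..2 + 2}) : bidegm (m + n)%MM = bidegm m + bidegm n.
Proof.
by rewrite /bidegm; congr pair; rewrite -PoszD -big_split;
  congr Posz; apply: eq_bigr => i _; rewrite mnmDE.
Qed.

Lemma bihomog0 d : bihomog d (0 : S).
Proof. by rewrite /bihomog msupp0. Qed.

Lemma bihomogD d p q : bihomog d p -> bihomog d q -> bihomog d (p + q).
Proof.
move=> /bihomogP hp /bihomogP hq; apply/bihomogP => m /msuppD_le.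
by rewrite mem_cat => /orP[/hp|/hq].
Qed.

Lemma bihomogZ d (c : k) p : bihomog d p -> bihomog d (c *: p).
Proof. by move=> /bihomogP hp; apply/bihomogP => m /msuppZ_le/hp. Qed.

Lemma bihomogN d p : bihomog d p -> bihomog d (- p).
Proof. by rewrite -scaleN1r; apply: bihomogZ. Qed.

Lemma bihomogM d e p q : bihomog d p -> bihomog e q -> bihomog (d + e) (p * q).
Proof.
move=> /bihomogP hp /bihomogP hq; apply/bihomogP => m /msuppM_le.
by case/allpairsP => -[m1 m2] /= [/hp <- /hq <- ->]; rewrite bidegmD.
Qed.

Lemma bihomog1 : bihomog 0 (1 : S).
Proof.
apply/bihomogP => m; rewrite msupp1 inE => /eqP ->.
by rewrite /bidegm !big1 // => i _; rewrite mnm0E.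
Qed.

Lemma bihomogX d p n : bihomog d p -> bihomog (d *+ n) (p ^+ n).
Proof.
move=> hp; elim: n => [|n IH]; first exact: bihomog1.
by rewrite exprS mulrS; apply: bihomogM.
Qed.

Lemma bihomog_sum d (I : Type) (r : seq I) (F : I -> S) :
  (forall i, bihomog d (F i)) -> bihomog d (\sum_(i <- r) F i).
Proof.
move=> h; elim/big_ind: _ => //; first exact: bihomog0.
by move=> p q; apply: bihomogD.
Qed.

Lemma bihomog_prod (d : int * int) (I : Type) (r : seq I) (F : I -> S) :
  (forall i, bihomog d (F i)) -> bihomog (d *+ size r) (\prod_(i <- r) F i).
Proof.
move=> h; elim: r => [|i r IH]; first by rewrite big_nil; apply: bihomog1.
by rewrite big_cons /= mulrS; apply: bihomogM.
Qed.

Lemma bihomog_x i : bihomog (1, 0) (x_ k i).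
Proof.
apply/bihomogP => m; rewrite msuppX inE => /eqP ->; rewrite /bidegm.
rewrite (bigD1 i) //= !mnm1E eqxx !big1 // => [j _|j ne].
  by rewrite mnm1E eq_lrshift.
by rewrite mnm1E eq_lshift eq_sym (negPf ne).
Qed.

Lemma bihomog_y i : bihomog (0, 1) (y_ k i).
Proof.
apply/bihomogP => m; rewrite msuppX inE => /eqP ->; rewrite /bidegm.
rewrite [X in (_, X%:Z)](bigD1 i) //= !mnm1E eqxx !big1 // => [j ne|j _].
  by rewrite mnm1E eq_rshift eq_sym (negPf ne).
by rewrite mnm1E eq_rlshift.
Qed.

End Bihomogeneous.

Section SheafTransfer.
Variable k : fieldType.
Local Notation S := {mpoly k[2 + 2]}.

Definition is_submod (M : gmod k) : Prop :=
  gsub (0 : 'rV[S]_(grank M)) /\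
  forall (p : S) (u v : 'rV[S]_(grank M)), gsub u -> gsub v -> gsub (p *: u + v).

Section Vanishing.
Variables (M : gmod k) (h : S).
Hypothesis subM : is_submod M.

Lemma gsubZ (p : S) (u : 'rV_(grank M)) : gsub u -> gsub (p *: u).
Proof. by move=> hu; rewrite -[_ *: _]addr0; apply: subM.2 => //; case: subM. Qed.

Lemma gsubD (u v : 'rV_(grank M)) : gsub u -> gsub v -> gsub (u + v).
Proof. by move=> hu hv; rewrite -[u]scale1r; apply: subM.2. Qed.

Definition frac_zero (s : Defs.frac M) := exists c, gsub (h ^+ c *: s.1).

Lemma frac_eq_zero (s t : Defs.frac M) : frac_eq h s t -> frac_zero t -> frac_zero s.
Proof.
move=> [c hc] [c' hc']; exists (c' + c + t.2)%N.
have -> : h ^+ (c' + c + t.2) *: s.1 =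
    h ^+ c' *: (h ^+ c *: (h ^+ t.2 *: s.1 - h ^+ s.2 *: t.1)) +
    h ^+ (c + s.2) *: (h ^+ c' *: t.1).
  rewrite !scalerBr !scalerA -!exprD.
  rewrite (_ : (c + s.2 + c' = c' + c + s.2)%N); last by lia.
  by rewrite -!addnA subrK.
by apply: gsubD; apply: gsubZ.
Qed.

Lemma frac_eq_sym (s t : Defs.frac M) : frac_eq h s t -> frac_eq h t s.
Proof.
move=> [c hc]; exists c; rewrite -opprB scalerN -scaleN1r.
exact: gsubZ.
Qed.

Lemma zero_frac_eq (s t : Defs.frac M) : frac_zero s -> frac_zero t -> frac_eq h s t.
Proof.
move=> [c hc] [c' hc']; exists (c + c')%N.
have -> : h ^+ (c + c') *: (h ^+ t.2 *: s.1 - h ^+ s.2 *: t.1) =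
  h ^+ (c' + t.2) *: (h ^+ c *: s.1) + (- h ^+ (c + s.2) *: (h ^+ c' *: t.1)).
  rewrite scalerBr !scalerA mulNr -!exprD scaleNr.
  by congr (h ^+ _ *: _ - h ^+ _ *: _); lia.
by apply: gsubD; apply: gsubZ.
Qed.

Lemma frac_eq_scale (p : S) b (s t : Defs.frac M) :
  frac_eq h s t -> frac_eq h (frac_scale p b s) (frac_scale p b t).
Proof.
move=> [c hc]; exists c; rewrite /= !scalerA.
have -> : h ^+ c *: ((h ^+ (b + t.2) * p) *: s.1 - (h ^+ (b + s.2) * p) *: t.1) =
   (h ^+ b * p) *: (h ^+ c *: (h ^+ t.2 *: s.1 - h ^+ s.2 *: t.1)).
  rewrite !scalerBr !scalerA !exprD; congr (_ *: _ - _ *: _); ring.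
exact: gsubZ.
Qed.

End Vanishing.

(** If [q] kills [M], then q / h^b kills the section [psi h t], hence also its image under [phi],
    which is [t]. *)
Lemma sheaf_iso_annihilator (M N : gmod k) (h q : S) d b t :
  is_submod M -> is_submod N -> sheaf_iso M N ->
  irrelevant h -> bihomog d h -> bihomog (d *+ b) q ->
  (forall v, gsub (q *: v : 'rV_(grank M))) ->
  is_section d t -> exists c, gsub (h ^+ c *: (q *: t.1) : 'rV_(grank N)).
Proof.
move=> sM sN [phi [psi [mphi mpsi _ phiK]]] hirr hd qd qM tsec.
pose s := psi h t.
have ssec : is_section d s by apply: (mor_section mpsi).
(* Zero is written as 0 times [s], so that [mor_scale] shows that [phi] sends it to zero. *)
have s0sec : is_section d (frac_scale 0 0 s).
  by move=> j; rewrite /= mxE mul0r bihomog0.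
have qsec : is_section d (frac_scale q b s).
  by move=> j; rewrite /= mxE mulrnDr -addrA; apply: bihomogM.
have zqs : frac_zero h (frac_scale q b s) by exists 0%N; apply: gsubZ => //; apply: qM.
have z0s : frac_zero h (frac_scale 0 0 s).
  by exists 0%N; rewrite /= scale0r scaler0; case: sM.
have zphi0 : frac_zero h (phi h (frac_scale 0 0 s)).
  apply: (frac_eq_zero sN (mor_scale mphi hirr hd _ ssec)); first by rewrite bihomog0.
  by exists 0%N; rewrite /= scale0r scaler0; case: sN.
have eqs := mor_eq mphi hirr hd qsec s0sec (zero_frac_eq sM zqs z0s).
have zphi := frac_eq_zero sN eqs zphi0.
have zscale : frac_zero h (frac_scale q b (phi h s)).
  exact: (frac_eq_zero sN (frac_eq_sym sN (mor_scale mphi hirr hd qd ssec)) zphi).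
have : frac_zero h (frac_scale q b t).
  apply: (frac_eq_zero sN _ zscale); apply: (frac_eq_scale sN).
  by apply: (frac_eq_sym sN); apply: (phiK h d).
by case=> c hc; exists c.
Qed.

Lemma sheaf_iso_sym (M N : gmod k) : sheaf_iso M N -> sheaf_iso N M.
Proof. by move=> [phi [psi [? ? ? ?]]]; exists psi, phi; split. Qed.

Section KoszulQuotient.
Variables (I : S -> Prop) (f g : S) (df dg : int * int).
Variables (hf : bihomog df f) (hg : bihomog dg g).
Hypothesis I0 : I 0.
Hypothesis Ilin : forall p u v, I u -> I v -> I (p * u + v).
Hypothesis iso : sheaf_iso (quot_ring I) (coker1 (koszul hf hg)).

Lemma is_submod_quot : is_submod (quot_ring I).
Proof.
split; first by rewrite /= mxE.
by move=> p u v /= hu hv; rewrite !mxE; apply: Ilin.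
Qed.

Lemma is_submod_coker : is_submod (coker1 (koszul hf hg)).
Proof.
split; first by exists 0; rewrite mul0mx.
by move=> p _ _ [u ->] [v ->]; exists (p *: u + v); rewrite mulmxDl scalemxAl.
Qed.

Lemma coker_gsubP (v : 'rV[S]_1) :
  gsub (v : 'rV_(grank (coker1 (koszul hf hg)))) <-> gen2 f g (v 0 0).
Proof.
split=> [[w ->]|[s [t st]]].
  exists (w 0 0), (w 0 1); rewrite mxE big_ord_recl big_ord1 !mxE /=.
  by congr (_ + w 0 _ * _); apply: val_inj.
exists (\row_j if j == 0 then s else t); apply/rowP => j; rewrite ord1 st.
by rewrite mxE big_ord_recl big_ord1 !mxE.
Qed.

(** An element of I annihilates S/I; apply the transfer of annihilators to the section 1 of the
    cokernel. *)
Lemma ideal_to_gen2 h d b q : irrelevant h -> bihomog d h -> bihomog (d *+ b) q ->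
  I q -> exists c, gen2 f g (h ^+ c * q).
Proof.
move=> hirr hd qd Iq.
have [||c] := sheaf_iso_annihilator (t := (const_mx 1, 0)) is_submod_quot
  is_submod_coker iso hirr hd qd.
- by move=> v; rewrite /= mxE mulrC -[_ * q]addr0; apply: Ilin.
- by move=> j; rewrite /= mxE subr0 mulr0n bihomog1.
by move/coker_gsubP; rewrite !mxE mulr1 => ?; exists c.
Qed.

Lemma gen2_to_ideal h d b q : irrelevant h -> bihomog d h -> bihomog (d *+ b) q ->
  gen2 f g q -> exists c, I (h ^+ c * q).
Proof.
move=> hirr hd qd [s [t st]].
have [||c] := sheaf_iso_annihilator (t := (const_mx 1, 0)) is_submod_coker
  is_submod_quot (sheaf_iso_sym iso) hirr hd qd.
- move=> v; apply/coker_gsubP; rewrite mxE st.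
  by exists (v 0 0 * s), (v 0 0 * t); ring.
- by move=> j; rewrite /= mxE subr0 mulr0n bihomog1.
by rewrite /= !mxE mulr1 => ?; exists c.
Qed.

End KoszulQuotient.
End SheafTransfer.

(** * Evaluation of bihomogeneous forms *)

Definition vec2 (R : Type) (a b : R) : 'rV[R]_2 := \row_i (if i == 0 then a else b).

Lemma map_vec2 (R R' : Type) (h : R -> R') a b :
  map_mx h (vec2 a b) = vec2 (h a) (h b).
Proof. by apply/rowP => i; rewrite !mxE; case: ifP. Qed.

Section Evaluation.
Variable k : fieldType.
Local Notation S := {mpoly k[2 + 2]}.

(** Coordinates lie in any algebra over [k], so that dehomogenizations, their top coefficients and
    their values are all evaluations, compared by [rmorph_ev]. *)
Definition ev (R : comNzRingType) (h : k -> R) (u v : 'rV[R]_2) (p : S) : R :=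
  mmap h (fun i => row_mx u v 0 i) p.

Section RingHom.
Variables (R : comNzRingType) (h : {rmorphism k -> R}).
Implicit Types u v : 'rV[R]_2.

HB.instance Definition _ u v := GRing.RMorphism.copy (ev h u v)
  (mmap h (fun i => row_mx u v 0 i)).

Lemma evE u v p : ev h u v p = \sum_(m <- msupp p) h p@_m *
  ((\prod_i u 0 i ^+ m (lshift 2 i)) * (\prod_i v 0 i ^+ m (rshift 2 i))).
Proof.
apply: eq_bigr => m _; congr (_ * _); rewrite /mmap1 big_split_ord /=.
by congr (_ * _); apply: eq_bigr => i _; rewrite ?row_mxEl ?row_mxEr.
Qed.

Lemma ev_x u v i : ev h u v (x_ k i) = u 0 i.
Proof. by rewrite /ev mmapX mmap1U row_mxEl. Qed.

Lemma ev_y u v i : ev h u v (y_ k i) = v 0 i.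
Proof. by rewrite /ev mmapX mmap1U row_mxEr. Qed.

Lemma evZ u v c p : ev h u v (c *: p) = h c * ev h u v p.
Proof. exact: mmapZ. Qed.

End RingHom.

Lemma rmorph_ev (R R' : comNzRingType) (h : {rmorphism k -> R})
    (phi : {rmorphism R -> R'}) u v p :
  phi (ev h u v p) = ev (phi \o h) (map_mx phi u) (map_mx phi v) p.
Proof.
rewrite [RHS](evE (phi \o h)) evE rmorph_sum; apply: eq_bigr => m _.
rewrite !rmorphM !rmorph_prod /=; congr (_ * (_ * _));
  by apply: eq_bigr => i _; rewrite mxE rmorphXn.
Qed.

Lemma eq_ev (R : comNzRingType) (h h' : k -> R) u v p :
  h =1 h' -> ev h u v p = ev h' u v p.
Proof. by move=> e; apply: eq_bigr => m _; rewrite e. Qed.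

End Evaluation.

Section TopCoefficients.
Variables (k : fieldType) (R : comNzRingType) (h : {rmorphism k -> R}).
Variables (a b : nat) (p : {mpoly k[2 + 2]}).
Hypothesis hp : bihomog (a%:Z, b%:Z) p.

Lemma coef_linXn (c : R) (n j : nat) : (n <= j)%N ->
  ((c *: 'X + 1) ^+ n)`_j = c ^+ n *+ (n == j).
Proof.
elim: n j => [|n IH] [|j] //; first by rewrite expr0 coef1.
  by rewrite expr0 coef1 mulr0n.
rewrite ltnS => lej; rewrite exprS mulrDl mul1r coefD -scalerAl coefZ coefXM /=.
rewrite !IH // 1?ltnW // eqSS.
have -> : (n == j.+1) = false by lia.
by rewrite mulr0n addr0 exprS mulrnAr.
Qed.

Lemma coef_term (C c : R) (i j n : nat) : (i + j <= n)%N ->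
  (C%:P * ('X ^+ i * (c *: 'X + 1) ^+ j))`_n = (C * c ^+ j) *+ (n == i + j)%N.
Proof.
move=> le; rewrite coefCM coefXnM ifF; last by lia.
rewrite coef_linXn; last by lia.
by rewrite (_ : (j == n - i)%N = (n == i + j)%N) ?mulrnAr //; lia.
Qed.

(** On the parametrized line ('X : c 'X + 1) the missing point is (1 : c), and the coefficient in
    degree b is the value of the form there. *)
Lemma ev_top_y (u : 'rV[R]_2) (c : R) :
  let F := ev (polyC \o h) (map_mx polyC u) (vec2 'X (c *: 'X + 1)) p in
  (size F <= b.+1)%N /\ F`_b = ev h u (vec2 1 c) p.
Proof.
move=> F.
have cF n : (b <= n)%N -> F`_n = ev h u (vec2 1 c) p *+ (n == b).
  move=> le; rewrite /F (evE (polyC \o h)) evE coef_sum -sumrMnl !big_seq.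
  apply: eq_bigr => m /(bihomogP _ _ hp) [_].
  rewrite !big_ord_recl !big_ord0 !addn0 !mulr1 !mxE /= => eb.
  rewrite expr1n mul1r -!rmorphXn -!rmorphM mulrA -rmorphM coef_term; last by lia.
  by rewrite eb !mulrA.
split; last by rewrite cF // eqxx.
by apply/leq_sizeP => j lt; rewrite cF 1?ltnW // (gtn_eqF lt).
Qed.

Lemma ev_top_x (v : 'rV[R]_2) (c : R) :
  let F := ev (polyC \o h) (vec2 'X (c *: 'X + 1)) (map_mx polyC v) p in
  (size F <= a.+1)%N /\ F`_a = ev h (vec2 1 c) v p.
Proof.
move=> F.
have cF n : (a <= n)%N -> F`_n = ev h (vec2 1 c) v p *+ (n == a).
  move=> le; rewrite /F (evE (polyC \o h)) evE coef_sum -sumrMnl !big_seq.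
  apply: eq_bigr => m /(bihomogP _ _ hp) [ea _]; move: ea.
  rewrite !big_ord_recl !big_ord0 !addn0 !mulr1 !mxE /= => ea.
  rewrite expr1n mul1r -!rmorphXn -!rmorphM [X in _ * X]mulrC [X in polyseq X]mulrA -rmorphM.
  rewrite coef_term; last by lia.
  by rewrite ea; congr (_ *+ _); ring.
split; last by rewrite cF // eqxx.
by apply/leq_sizeP => j lt; rewrite cF 1?ltnW // (gtn_eqF lt).
Qed.

End TopCoefficients.

(** * Passing between forms and polynomials in an affine chart *)

Section Dehomogenization.
Variables (k : fieldType) (alpha beta : k).
Local Notation S := {mpoly k[2 + 2]}.
Local Notation ev0 := (ev (@idfun k)).

(* Affine coordinates s, t on the complement of the rulings through the         *)
(* points (1 : alpha) and (1 : beta); t is the outer variable.                  *)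
Definition dehom (p : S) : {poly {poly k}} :=
  ev (polyC \o polyC) (map_mx polyC (vec2 'X (alpha *: 'X + 1)))
     (vec2 'X (beta%:P *: 'X + 1)) p.

HB.instance Definition _ := GRing.RMorphism.copy dehom
  (ev (polyC \o polyC) (map_mx polyC (vec2 'X (alpha *: 'X + 1)))
     (vec2 'X (beta%:P *: 'X + 1))).

Lemma dehomZ c p : dehom (c *: p) = c%:P%:P * dehom p.
Proof. exact: (@evZ k {poly {poly k}} (polyC \o polyC)). Qed.

Lemma dehom_x i : dehom (x_ k i) = (vec2 'X (alpha *: 'X + 1) 0 i)%:P.
Proof. by rewrite /dehom (@ev_x k {poly {poly k}} (polyC \o polyC)) mxE. Qed.

Lemma dehom_y i : dehom (y_ k i) = vec2 'X (beta%:P *: 'X + 1) 0 i.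
Proof. by rewrite /dehom (@ev_y k {poly {poly k}} (polyC \o polyC)). Qed.

Lemma swap_dehom p : swapXY (dehom p) =
  ev (polyC \o polyC) (vec2 'X (alpha%:P *: 'X + 1))
     (map_mx polyC (vec2 'X (beta *: 'X + 1))) p.
Proof.
rewrite /dehom.
rewrite (@rmorph_ev k {poly {poly k}} {poly {poly k}} (polyC \o polyC) swapXY).
rewrite !map_vec2 /=.
have -> : swapXY (alpha *: 'X + 1)%:P = alpha%:P *: 'X + 1.
  by rewrite swapXY_polyC rmorphD rmorph1 /= map_polyZ /= map_polyX.
have -> : swapXY (beta%:P *: 'X + 1) = (beta *: 'X + 1)%:P.
  apply: (can_inj (@swapXYK _)); rewrite swapXYK swapXY_polyC rmorphD rmorph1 /=.
  by rewrite map_polyZ /= map_polyX.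
rewrite swapXY_X swapXY_polyC map_polyX.
by apply: eq_ev => c /=; rewrite swapXY_polyC map_polyC.
Qed.

Lemma horner_dehom p s t : (dehom p).[t, s] =
  ev0 (vec2 s (alpha * s + 1)) (vec2 t (beta * t + 1)) p.
Proof.
pose phi := GRing.RMorphism.clone _ _ (horner_eval s \o horner_eval t%:P) _.
rewrite -[LHS]/(phi (dehom p)) /dehom.
rewrite (@rmorph_ev k {poly {poly k}} k (polyC \o polyC) phi) !map_vec2.
rewrite /phi /= /horner_eval !hornerE.
by apply: eq_ev => c /=; rewrite /horner_eval !hornerE.
Qed.

Section Form.
Variables (a b : nat) (p : S).
Hypothesis hp : bihomog (a%:Z, b%:Z) p.

Lemma size_dehom : (size (dehom p) <= b.+1)%N.
Proof. by have [] := ev_top_y polyC hp (vec2 'X (alpha *: 'X + 1)) beta%:P. Qed.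

Lemma size_swap_dehom : (size (swapXY (dehom p)) <= a.+1)%N.
Proof.
rewrite swap_dehom.
by have [] := ev_top_x polyC hp (vec2 'X (beta *: 'X + 1)) alpha%:P.
Qed.

Lemma coef_dehom : (dehom p)`_b =
  ev polyC (vec2 'X (alpha *: 'X + 1)) (vec2 1 beta%:P) p.
Proof. by have [] := ev_top_y polyC hp (vec2 'X (alpha *: 'X + 1)) beta%:P. Qed.

Lemma coef_swap_dehom : (swapXY (dehom p))`_a =
  ev polyC (vec2 1 alpha%:P) (vec2 'X (beta *: 'X + 1)) p.
Proof.
rewrite swap_dehom.
by have [] := ev_top_x polyC hp (vec2 'X (beta *: 'X + 1)) alpha%:P.
Qed.

Lemma horner_coef_dehom s : ((dehom p)`_b).[s] =
  ev0 (vec2 s (alpha * s + 1)) (vec2 1 beta) p.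
Proof.
rewrite coef_dehom -/(horner_eval s _).
rewrite (@rmorph_ev k {poly k} k polyC (horner_eval s)) !map_vec2 /= /horner_eval !hornerE.
by apply: eq_ev => c /=; rewrite /horner_eval hornerC.
Qed.

Lemma horner_coef_swap_dehom t : ((swapXY (dehom p))`_a).[t] =
  ev0 (vec2 1 alpha) (vec2 t (beta * t + 1)) p.
Proof.
rewrite coef_swap_dehom -/(horner_eval t _).
rewrite (@rmorph_ev k {poly k} k polyC (horner_eval t)) !map_vec2 /= /horner_eval !hornerE.
by apply: eq_ev => c /=; rewrite /horner_eval hornerC.
Qed.

Lemma coef2_dehom : (dehom p)`_b`_a = ev0 (vec2 1 alpha) (vec2 1 beta) p.
Proof.
rewrite coef_dehom; have [_ <-] := ev_top_x idfun hp (vec2 1 beta) alpha.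
by rewrite map_vec2.
Qed.

End Form.

(** The bidegree (N, N) is a multiple of (1, 1), the bidegree of the form [h] that cuts out the
    chart, as the comparison of ideals on D(h) requires. *)
Definition homogenize (N : nat) (p : {poly {poly k}}) : S :=
  \sum_(j < N) \sum_(i < N) p`_j`_i *:
    (x_ k 0 ^+ i * (x_ k 1 - alpha *: x_ k 0) ^+ (N - i) *
     (y_ k 0 ^+ j * (y_ k 1 - beta *: y_ k 0) ^+ (N - j))).

Lemma bihomog_homogenize N (p : {poly {poly k}}) : bihomog ((1, 1) *+ N) (homogenize N p).
Proof.
do 2![apply: bihomog_sum => ?]; apply: bihomogZ.
set i := (X in x_ k 0 ^+ X); set j := (X in y_ k 0 ^+ X).
have -> : (1, 1) *+ N = (1, 0) *+ i + (1, 0) *+ (N - i) +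
                        ((0, 1) *+ j + (0, 1) *+ (N - j)) :> (int * int)%type.
  rewrite -!mulrnDr !subnKC ?(ltnW (ltn_ord _)) //.
  exact: (mulrnDl N ((1, 0) : (int * int)%type) (0, 1)).
do 2![apply: bihomogM]; apply: bihomogX; rewrite ?bihomog_x ?bihomog_y //.
  by apply: bihomogD; [|apply: bihomogN; apply: bihomogZ]; apply: bihomog_x.
by apply: bihomogD; [|apply: bihomogN; apply: bihomogZ]; apply: bihomog_y.
Qed.

Lemma ev_homogenize N (p : {poly {poly k}}) (u v : 'rV[k]_2) :
  (size p <= N)%N -> (size (swapXY p) <= N)%N ->
  u 0 1 - alpha * u 0 0 != 0 -> v 0 1 - beta * v 0 0 != 0 ->
  ev0 u v (homogenize N p) =
    (u 0 1 - alpha * u 0 0) ^+ N * (v 0 1 - beta * v 0 0) ^+ N *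
    p.[v 0 0 / (v 0 1 - beta * v 0 0), u 0 0 / (u 0 1 - alpha * u 0 0)].
Proof.
move=> sp sp'; set x := _ - _; set y := _ - _ => nzx nzy.
rewrite (horner_coef_wide _ sp) horner_sum mulr_sumr /homogenize rmorph_sum.
apply: eq_bigr => j _; rewrite rmorph_sum /=.
have sj : (size (p`_j)%R <= N)%N.
  by rewrite (leq_trans (max_size_coefXY _ _)) // sizeYE.
rewrite hornerM -rmorphXn hornerC (horner_coef_wide _ sj) mulr_suml mulr_sumr.
apply: eq_bigr => i _; rewrite (evZ idfun) /= !rmorphM !rmorphXn !rmorphB /=.
rewrite !(evZ idfun) !(ev_x idfun) !(ev_y idfun) -/x -/y.
rewrite !exprMn !exprVn.
have eX (z : k) (l : 'I_N) : z ^+ N = z ^+ l * z ^+ (N - l).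
  by rewrite -exprD subnKC // ltnW.
by rewrite (eX x i) (eX y j); field; rewrite !expf_neq0.
Qed.

Lemma dehom_lx : dehom (x_ k 1 - alpha *: x_ k 0) = 1.
Proof.
by rewrite rmorphB /= dehomZ !dehom_x !mxE /= -rmorphM mul_polyC -rmorphB addrC addKr.
Qed.

Lemma dehom_ly : dehom (y_ k 1 - beta *: y_ k 0) = 1.
Proof. by rewrite rmorphB /= dehomZ !dehom_y !mxE /= mul_polyC addrC addKr. Qed.

Lemma dehom_homogenize N (p : {poly {poly k}}) : (size p <= N)%N -> (size (swapXY p) <= N)%N ->
  dehom (homogenize N p) = p.
Proof.
move=> sp sp'; have dx : dehom (x_ k 0) = 'X%:P by rewrite dehom_x mxE.
have dy : dehom (y_ k 0) = 'X by rewrite dehom_y mxE.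
have coefE (R : nzRingType) (q : {poly R}) :
    (size q <= N)%N -> q = \sum_(i < N) q`_i *: 'X^i.
  by move=> sq; rewrite -{1}(take_poly_id sq) /take_poly poly_def.
rewrite [RHS](coefE _ _ sp) /homogenize rmorph_sum; apply: eq_bigr => j _.
rewrite -mul_polyC.
have sj : (size (p`_j)%R <= N)%N.
  by rewrite (leq_trans (max_size_coefXY _ _)) // sizeYE.
rewrite {2}(coefE _ _ sj) rmorph_sum rmorph_sum mulr_suml; apply: eq_bigr => i _.
rewrite /= dehomZ.
rewrite !rmorphM !rmorphXn /= dehom_lx dehom_ly dx dy !expr1n !mulr1 /= mulrA.
by rewrite -mul_polyC rmorphM rmorphXn.
Qed.

End Dehomogenization.

(** * Points of P^1 and affine coordinates *)

Lemma row2P (T : Type) (u v : 'rV[T]_2) :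
  u 0 0 = v 0 0 -> u 0 1 = v 0 1 -> u = v.
Proof.
move=> e0 e1; apply/rowP; case=> [[|[|//]] lt].
  by rewrite (_ : Ordinal lt = 0); last exact: val_inj.
by rewrite (_ : Ordinal lt = 1); last exact: val_inj.
Qed.

Section ProjectiveLine.
Variable k : fieldType.
Implicit Types (L : P1 k) (u w : 'rV[k]_2).

Definition rep L : 'rV[k]_2 := vpick (val L).

Lemma rep_mem L : rep L \in val L.
Proof. exact: memv_pick. Qed.

Lemma rep_neq0 L : rep L != 0.
Proof.
rewrite vpick0; case: L => U /= /eqP dU.
by apply/eqP => U0; move: dU; rewrite U0 dimv0.
Qed.

Lemma P1_line L u : u != 0 -> u \in val L -> val L = <[u]>%VS.
Proof.
move=> nzu uL; apply/esym/eqP; rewrite eqEdim dim_vline nzu -memvE uL /=.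
by rewrite (eqP (valP L)).
Qed.

Lemma P1_eq L L' u : u != 0 -> u \in val L -> u \in val L' -> L = L'.
Proof.
by move=> nzu uL uL'; apply: val_inj; rewrite (P1_line nzu uL) (P1_line nzu uL').
Qed.

Lemma mem_vline2 u w : w != 0 -> w 0 1 * u 0 0 = w 0 0 * u 0 1 -> u \in <[w]>%VS.
Proof.
move=> nzw e; have [w0|w0] := eqVneq (w 0 0) 0; last first.
  apply/vlineP; exists (u 0 0 / w 0 0); apply: row2P; rewrite mxE.
    by rewrite divfK.
  by rewrite mulrAC [_ * w 0 1]mulrC e mulrAC mulfV // mul1r.
have w1 : w 0 1 != 0.
  by apply: contraNneq nzw => w1; apply/eqP/row2P; rewrite mxE.
apply/vlineP; exists (u 0 1 / w 0 1); apply: row2P; rewrite mxE.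
  by apply: (mulfI w1); rewrite e w0 mul0r mulr0 mulr0.
by rewrite divfK.
Qed.

Section AffineCoordinate.
Variable alpha : k.

(** This says that [L] is not (1 : alpha); [coord] is then the parameter s with [L] = (s : alpha s +
    1). *)
Definition finite_at L := rep L 0 1 - alpha * rep L 0 0 != 0.
Definition coord L : k := rep L 0 0 / (rep L 0 1 - alpha * rep L 0 0).

Lemma coordE L u : finite_at L -> u != 0 -> u \in val L ->
  u 0 1 - alpha * u 0 0 != 0 /\ u 0 0 / (u 0 1 - alpha * u 0 0) = coord L.
Proof.
move=> fin nzu; rewrite (P1_line (rep_neq0 L) (rep_mem L)) => /vlineP[z uE].
have nzz : z != 0 by apply: contraNneq nzu => z0; rewrite uE z0 scale0r.
rewrite uE !mxE.
have -> : z * rep L 0 1 - alpha * (z * rep L 0 0) =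
  z * (rep L 0 1 - alpha * rep L 0 0) by ring.
split; first by rewrite mulf_neq0.
by rewrite /coord -mulf_div divff // mul1r.
Qed.

Lemma vec2_neq0 (s : k) : vec2 s (alpha * s + 1) != 0.
Proof.
apply/eqP => /rowP h; have := h 1; have := h 0; rewrite !mxE /= => ->.
by rewrite mulr0 add0r => /eqP; rewrite oner_eq0.
Qed.

Lemma coord_mem L : finite_at L -> vec2 (coord L) (alpha * coord L + 1) \in val L.
Proof.
move=> fin; set z := rep L 0 1 - alpha * rep L 0 0.
have -> : vec2 (coord L) (alpha * coord L + 1) = z^-1 *: rep L.
  apply: row2P; rewrite !mxE /coord -/z.
    by rewrite eqxx mulrC.
  apply: (mulfI fin); rewrite -/z /= mulrDr mulr1 mulVKf //.
  by rewrite mulrCA [z * (_ / z)]mulrC divfK // /z addrC subrK.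
by rewrite memvZ ?rep_mem.
Qed.

Lemma coord_inj L L' : finite_at L -> finite_at L' -> coord L = coord L' -> L = L'.
Proof.
move=> fin fin' e; apply: (P1_eq (vec2_neq0 (coord L))); first exact: coord_mem.
by rewrite e coord_mem.
Qed.

Lemma infinity_notin L : finite_at L -> vec2 1 alpha \notin val L.
Proof.
move=> fin; apply/negP => hin; have [|] := coordE fin _ hin.
  apply/eqP => /rowP /(_ 0) /eqP; rewrite !mxE /=; apply/negP; exact: oner_neq0.
by rewrite !mxE /= mulr1 subrr eqxx.
Qed.

End AffineCoordinate.
End ProjectiveLine.

Section ClosedField.
Variable k : closedFieldType.

Lemma coprimep_no_root (p q : {poly k}) :
  (forall x, p.[x] = 0 -> q.[x] = 0 -> False) -> coprimep p q.
Proof.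
move=> h; rewrite coprimep_def; apply/negPn/negP => /closed_rootP[x].
by rewrite root_gcd => /andP[/rootP px /rootP qx]; apply: (h x).
Qed.

(** Euclid's argument: a root of 1 plus the product of the ['X - z%:P] is not in [s]. *)
Lemma exists_notin (s : seq k) : exists x, x \notin s.
Proof.
have [->|nzs] := eqVneq s [::]; first by exists 0.
have : size (\prod_(z <- s) ('X - z%:P) + 1) != 1%N.
  rewrite size_polyDl ?size_prod_XsubC ?size_poly1 ?ltnS ?eqSS ?size_eq0 //.
  by rewrite lt0n size_eq0.
case/closed_rootP => x /rootP; rewrite hornerD hornerC => h; exists x.
rewrite -root_prod_XsubC; apply/negP => /rootP h'.
by move: h; rewrite h' add0r => /eqP; rewrite oner_eq0.
Qed.

Lemma exists_finite_at (s : seq (P1 k)) :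
  exists alpha, forall L, L \in s -> finite_at alpha L.
Proof.
have [x xs] := exists_notin [seq rep L 0 1 / rep L 0 0 | L <- s].
exists x => L Ls; apply: contraNneq xs => e; apply/mapP; exists L => //.
(* When the first coordinate is 0 the listed slope is the default 0, but (0 : 1) is finite for every
   choice of [x]. *)
have [h0|h0] := eqVneq (rep L 0 0) 0; last first.
  by move/eqP: e; rewrite subr_eq0 => /eqP ->; rewrite mulfK.
have /negP[] := rep_neq0 L; apply/eqP/row2P; rewrite mxE //.
by move: e; rewrite h0 mulr0 subr0.
Qed.

End ClosedField.

(** * The two generators in an affine chart *)

Lemma gen2_mulr (k : fieldType) (p q r s : {mpoly k[2 + 2]}) :
  gen2 p q r -> gen2 p q (r * s).
Proof. by move=> [u [v ->]]; exists (u * s), (v * s); ring. Qed.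

Lemma irrelevant_mul (k : fieldType) (p q : {mpoly k[2 + 2]}) :
  gen2 (x_ k 0) (x_ k 1) p -> gen2 (y_ k 0) (y_ k 1) q -> irrelevant (p * q).
Proof. by split; [|rewrite mulrC]; apply: gen2_mulr. Qed.

Lemma gen2_coord (k : fieldType) (z : 'I_2 -> {mpoly k[2 + 2]}) i :
  gen2 (z 0) (z 1) (z i).
Proof.
case: i => [[|[|//]] lt].
  by exists 1, 0; rewrite mul1r mul0r addr0; congr z; apply: val_inj.
by exists 0, 1; rewrite mul1r mul0r add0r; congr z; apply: val_inj.
Qed.

Lemma pair_mulrn (x y : int) n : (x, y) *+ n = (x *+ n, y *+ n).
Proof. by elim: n => // n IH; rewrite !mulrS IH. Qed.

Lemma bihomog_nat (k : fieldType) d (p : {mpoly k[2 + 2]}) :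
  bihomog d p -> exists a b : nat, bihomog (a%:Z, b%:Z) p.
Proof.
case E: (msupp p) => [|m ms] hp; first by exists 0%N, 0%N; rewrite /bihomog E.
have md : bidegm m = d by apply: (bihomogP _ _ hp); rewrite E mem_head.
by move: hp; rewrite -md /bidegm => hp; do 2!eexists; exact: hp.
Qed.

Section LocalEquality.
Variables (k : closedFieldType) (X : {fset P1 k * P1 k}).
Local Notation S := {mpoly k[2 + 2]}.
Local Notation I := (vanishing_ideal X).
Local Notation ev0 := (ev (@idfun k)).
Variables (f g : S).
Hypothesis I_to_gen2 : forall (h : S) d n q, irrelevant h -> bihomog d h ->
  bihomog (d *+ n) q -> I q -> exists c, gen2 f g (h ^+ c * q).
Hypothesis gen2_to_I : forall (h : S) d n q, irrelevant h -> bihomog d h ->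
  bihomog (d *+ n) q -> gen2 f g q -> exists c, I (h ^+ c * q).

Lemma bihomog_xy i j : bihomog (1, 1) (x_ k i * y_ k j).
Proof. exact: (bihomogM (bihomog_x k i) (bihomog_y k j)). Qed.

Lemma irrelevant_xy i j : irrelevant (x_ k i * y_ k j).
Proof.
by apply: irrelevant_mul; [apply: (gen2_coord (x_ k)) | apply: (gen2_coord (y_ k))].
Qed.

(** Near each point some [x_ k i * y_ k j] is nonzero, and its powers can be cancelled after
    evaluation. *)
Lemma gen2_vanishing (a b : nat) q :
  bihomog (a%:Z, b%:Z) q -> gen2 f g q -> I q.
Proof.
move=> hq gq P PX u v uP nzu vP nzv.
have /rV0Pn[i nzi] := nzu; have /rV0Pn[j nzj] := nzv.
(* These exponents balance the bidegree to (a + b, a + b), a multiple of (1, 1). *)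
pose q' := q * (x_ k i ^+ b * y_ k j ^+ a).
have hq' : bihomog ((1, 1) *+ (a + b)) q'.
  have -> : (1, 1) *+ (a + b) =
      (a%:Z, b%:Z) + ((1, 0) *+ b + (0, 1) *+ a) :> (int * int)%type.
    rewrite !pair_mulrn; congr pair => /=; rewrite !mul0rn ?addr0 ?add0r !natz //.
    by rewrite PoszD addrC.
  by do 2?[apply: bihomogM => //]; apply: bihomogX; rewrite ?bihomog_x ?bihomog_y.
have [|c] := gen2_to_I (irrelevant_xy i j) (bihomog_xy i j) hq'.
  exact: gen2_mulr.
move=> /(_ P PX u v uP nzu vP nzv).
change (ev0 u v ((x_ k i * y_ k j) ^+ c * q') = 0 -> ev0 u v q = 0).
rewrite /q' !rmorphM !rmorphXn !rmorphM /= !(ev_x idfun) !(ev_y idfun).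
move/eqP; rewrite !(mulf_eq0, expf_eq0) (negPf nzi) (negPf nzj) !andbF /=.
by rewrite !orbF => /eqP.
Qed.

(** Away from X some form of I is nonzero at (u, v); times a power of a monomial nonzero there it
    lies in (f, g), so f and g cannot both vanish. *)
Lemma common_zero (u v : 'rV[k]_2) : u != 0 -> v != 0 -> ev0 u v f = 0 -> ev0 u v g = 0 ->
  exists2 P, P \in X & u \in val P.1 /\ v \in val P.2.
Proof.
move=> nzu nzv fz gz.
have [/hasP[P PX /andP[]]|/hasPn noP] :=
  boolP (has (fun P : P1 k * P1 k => (u \in val P.1) && (v \in val P.2)) (enum_fset X)); first by exists P.
have /rV0Pn[i nzi] := nzu; have /rV0Pn[j nzj] := nzv.
pose lx (w : 'rV[k]_2) : S := w 0 1 *: x_ k 0 - w 0 0 *: x_ k 1.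
pose ly (w : 'rV[k]_2) : S := w 0 1 *: y_ k 0 - w 0 0 *: y_ k 1.
have lxE u' v' w : ev0 u' v' (lx w) = w 0 1 * u' 0 0 - w 0 0 * u' 0 1.
  by rewrite rmorphB /= !(evZ idfun) !(ev_x idfun).
have lyE u' v' w : ev0 u' v' (ly w) = w 0 1 * v' 0 0 - w 0 0 * v' 0 1.
  by rewrite rmorphB /= !(evZ idfun) !(ev_y idfun).
have det0 (w : 'rV[k]_2) (L : P1 k) : w \in val L ->
    rep L 0 1 * w 0 0 - rep L 0 0 * w 0 1 = 0.
  rewrite (P1_line (rep_neq0 L) (rep_mem L)) => /vlineP[z ->].
  by rewrite !mxE; ring.
have det_neq0 (w : 'rV[k]_2) (L : P1 k) : w \notin val L ->
    rep L 0 1 * w 0 0 - rep L 0 0 * w 0 1 != 0.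
  apply: contra; rewrite subr_eq0 => /eqP.
  by move/(mem_vline2 (rep_neq0 L)); rewrite -(P1_line (rep_neq0 L) (rep_mem L)).
(* Each factor vanishes at [P] but not at (u, v): it uses a ruling through [P] that misses (u, v),
   padded by a nonzero coordinate to bidegree (1, 1). *)
pose fac (P : P1 k * P1 k) :=
  if u \in val P.1 then x_ k i * ly (rep P.2) else lx (rep P.1) * y_ k j.
pose q := \prod_(P <- enum_fset X) fac P.
have hq : bihomog ((1, 1) *+ size (enum_fset X)) q.
  apply: bihomog_prod => P; rewrite /fac; case: ifP => _.
    apply: (@bihomogM _ (1, 0) (0, 1) _ _ (bihomog_x k i)); apply: bihomogD; last apply: bihomogN;
      by apply: bihomogZ; apply: bihomog_y.
  apply: (@bihomogM _ (1, 0) (0, 1) _ _ _ (bihomog_y k j)); apply: bihomogD; last apply: bihomogN;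
    by apply: bihomogZ; apply: bihomog_x.
have Iq : I q.
  move=> P PX u' v' uP nzu' vP nzv'.
  change (ev0 u' v' q = 0); rewrite rmorph_prod /=.
  apply/eqP; rewrite prodf_seq_eq0; apply/hasP; exists P => //=.
  rewrite /fac; case: ifP => _; rewrite rmorphM /= ?lxE ?lyE det0 //.
    by rewrite mulr0.
  by rewrite mul0r.
have [c [s [t /(congr1 (ev0 u v))]]] :=
  I_to_gen2 (irrelevant_xy i j) (bihomog_xy i j) hq Iq.
rewrite rmorphD !rmorphM /= fz gz !mulr0 addr0 => /eqP.
rewrite rmorphXn rmorphM /= (ev_x idfun) (ev_y idfun) rmorph_prod /=.
rewrite !(mulf_eq0, expf_eq0) (negPf nzi) (negPf nzj) andbF /= => /negPn/negP[].
rewrite prodf_seq_neq0; apply/allP => P PX /=; move: (noP P PX); rewrite /fac.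
case: ifP => uP /=; rewrite rmorphM /= ?lxE ?lyE ?(ev_x idfun) ?(ev_y idfun) => vP.
  by rewrite mulf_neq0 ?det_neq0.
by rewrite mulf_neq0 ?det_neq0 // uP.
Qed.

Section AffineChart.
Variables (alpha beta : k).
Hypothesis fin1 : forall P, P \in X -> finite_at alpha P.1.
Hypothesis fin2 : forall P, P \in X -> finite_at beta P.2.
Local Notation dh := (dehom alpha beta).

Definition affine_points : seq (k * k) :=
  [seq (coord alpha P.1, coord beta P.2) | P <- enum_fset X].

Lemma vanishing_dehom q : I q -> vanishes_on affine_points (dh q).
Proof.
move=> Iq z /mapP[P PX ->] /=; rewrite horner_dehom.
by apply: (Iq P PX); rewrite ?vec2_neq0 ?coord_mem ?fin1 ?fin2.
Qed.

(** Homogenize, compare the ideals on D(h) for h = lx * ly, and dehomogenize: the power of h becomes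
    1. *)
Lemma affine_ideal p : vanishes_on affine_points p ->
  exists u v, p = u * dh f + v * dh g.
Proof.
move=> vp; pose N := maxn (size p) (size (swapXY p)).
have [sp sp'] : (size p <= N)%N /\ (size (swapXY p) <= N)%N.
  by rewrite leq_maxl leq_maxr.
pose lx := x_ k 1 - alpha *: x_ k 0; pose ly := y_ k 1 - beta *: y_ k 0.
have hirr : irrelevant (lx * ly).
  apply: irrelevant_mul.
    by exists (- alpha%:MP), 1; rewrite mulNr mul_mpolyC mul1r addrC.
  by exists (- beta%:MP), 1; rewrite mulNr mul_mpolyC mul1r addrC.
have hh : bihomog (1, 1) (lx * ly).
  apply: (@bihomogM _ (1, 0) (0, 1)); apply: bihomogD;
    rewrite ?bihomog_x ?bihomog_y ?bihomogN ?bihomogZ ?bihomog_x ?bihomog_y //.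
have Ih : I (homogenize alpha beta N p).
  move=> P PX u v uP nzu vP nzv.
  change (ev0 u v (homogenize alpha beta N p) = 0).
  have [nz1 c1] := coordE (fin1 PX) nzu uP.
  have [nz2 c2] := coordE (fin2 PX) nzv vP.
  rewrite ev_homogenize // c1 c2 (vp (coord alpha P.1, coord beta P.2)) ?mulr0 //.
  exact: (map_f (fun P => (coord alpha P.1, coord beta P.2))).
have [c [s [t /(congr1 dh)]]] :=
  I_to_gen2 hirr hh (bihomog_homogenize alpha beta N p) Ih.
rewrite rmorphD !rmorphM rmorphXn rmorphM /= dehom_homogenize // dehom_lx dehom_ly.
by rewrite mulr1 expr1n mul1r => ->; exists (dh s), (dh t).
Qed.

Section Degrees.
Variables (a b c d : nat).
Hypothesis hf : bihomog (a%:Z, b%:Z) f.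
Hypothesis hg : bihomog (c%:Z, d%:Z) g.

Lemma no_common_zero (u v : 'rV[k]_2) : u != 0 -> v != 0 ->
  (forall P, P \in X -> u \in val P.1 -> v \in val P.2 -> False) ->
  ev0 u v f = 0 -> ev0 u v g = 0 -> False.
Proof.
move=> nzu nzv h fz gz.
by have [P PX [uP vP]] := common_zero nzu nzv fz gz; apply: (h P).
Qed.

Lemma infinity_neq0 (x : k) : vec2 1 x != 0.
Proof.
by apply/eqP => /rowP/(_ 0)/eqP; rewrite !mxE /= oner_eq0.
Qed.

(** A common root would be a common zero of f and g on the vertical ruling at infinity, which avoids
    X. *)
Lemma coprimep_s : coprimep (swapXY (dh f))`_a (swapXY (dh g))`_c.
Proof.
apply: coprimep_no_root => t.
rewrite (horner_coef_swap_dehom _ _ hf) (horner_coef_swap_dehom _ _ hg).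
apply: no_common_zero; rewrite ?infinity_neq0 ?vec2_neq0 // => P PX uP _.
by have := infinity_notin (fin1 PX); rewrite uP.
Qed.

Lemma coprimep_t : coprimep (dh f)`_b (dh g)`_d.
Proof.
apply: coprimep_no_root => s.
rewrite (horner_coef_dehom _ _ hf) (horner_coef_dehom _ _ hg).
apply: no_common_zero; rewrite ?infinity_neq0 ?vec2_neq0 // => P PX _ vP.
by have := infinity_notin (fin2 PX); rewrite vP.
Qed.

Lemma corner_neq0 : ((dh f)`_b`_a != 0) || ((dh g)`_d`_c != 0).
Proof.
rewrite -negb_and; apply/negP => /andP[/eqP fz /eqP gz]; move: fz gz.
rewrite (coef2_dehom _ _ hf) (coef2_dehom _ _ hg).
apply: no_common_zero; rewrite ?infinity_neq0 // => P PX uP _.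
by have := infinity_notin (fin1 PX); rewrite uP.
Qed.

Lemma bidegree_le_card : (b * c <= #|` X|)%N.
Proof.
rewrite -(size_map (fun P => (coord alpha P.1, coord beta P.2))).
apply: (bidegree_product_le affine_ideal (size_dehom _ _ hf) (size_swap_dehom _ _ hf)
  (size_dehom _ _ hg) (size_swap_dehom _ _ hg) coprimep_s coprimep_t corner_neq0).
Qed.

End Degrees.

Section Rulings.
Variables (a b : nat) (q : S) (P : P1 k * P1 k).
Hypotheses (hq : bihomog (a%:Z, b%:Z) q) (Iq : I q).

(** The restriction of [q] to the ruling is a nonzero polynomial of degree at most a, with a
    distinct root for each point of X on it. *)
Lemma horizontal_ruling :
  (dh q).[(coord beta P.2)%:P] != 0 -> (on_horizontal X P.2 <= a)%N.
Proof.
move=> nz; rewrite /on_horizontal -(size_map (fun Q => coord alpha Q.1)) -ltnS.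
apply: leq_trans (_ : size (dh q).[(coord beta P.2)%:P] <= _)%N; last first.
  apply: leq_trans (max_size_evalC _ _) _; rewrite sizeYE.
  exact: (size_swap_dehom _ _ hq).
apply: max_poly_roots => //.
  apply/allP => _ /mapP[Q + ->]; rewrite !inE => /andP[QX /eqP <-].
  apply/rootP; apply: (vanishing_dehom Iq (z := (coord alpha Q.1, coord beta Q.2))).
  exact: (map_f (fun P => (coord alpha P.1, coord beta P.2))).
rewrite map_inj_in_uniq ?fset_uniq // => -[Q1 Q2] [R1 R2].
rewrite !inE /= => /andP[QX /eqP->] /andP[RX /eqP->] e; congr pair.
exact: (coord_inj (fin1 QX) (fin1 RX)).
Qed.

Lemma vertical_ruling :
  (swapXY (dh q)).[(coord alpha P.1)%:P] != 0 -> (on_vertical X P.1 <= b)%N.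
Proof.
move=> nz; rewrite /on_vertical -(size_map (fun Q => coord beta Q.2)) -ltnS.
apply: leq_trans (_ : size (swapXY (dh q)).[(coord alpha P.1)%:P] <= _)%N; last first.
  apply: leq_trans (max_size_evalC _ _) _; rewrite sizeYE swapXYK.
  exact: (size_dehom _ _ hq).
apply: max_poly_roots => //.
  apply/allP => _ /mapP[Q + ->]; rewrite !inE => /andP[QX /eqP <-].
  apply/rootP; rewrite horner2_swapXY.
  apply: (vanishing_dehom Iq (z := (coord alpha Q.1, coord beta Q.2))).
  exact: (map_f (fun P => (coord alpha P.1, coord beta P.2))).
rewrite map_inj_in_uniq ?fset_uniq // => -[Q1 Q2] [R1 R2].
rewrite !inE /= => /andP[QX /eqP->] /andP[RX /eqP->] e; congr pair.
exact: (coord_inj (fin2 QX) (fin2 RX)).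
Qed.

End Rulings.
End AffineChart.
End LocalEquality.

(** * Combining the bounds on the two rulings *)

Lemma gen2C (k : fieldType) (p q r : {mpoly k[2 + 2]}) : gen2 p q r -> gen2 q p r.
Proof. by move=> [u [v ->]]; exists v, u; rewrite addrC. Qed.

(** If both polynomials vanished on a ruling, all their s-coefficients would have the common root
    [t]. *)
Lemma coprimep_coef_horner_polyC (k : fieldType) (F G : {poly {poly k}}) a c t :
  coprimep (swapXY F)`_a (swapXY G)`_c ->
  (F.[t%:P] != 0) || (G.[t%:P] != 0).
Proof.
move=> cop; rewrite -negb_and; apply/negP => /andP[/eqP F0 /eqP G0].
have := congr1 (fun p : {poly k} => p`_a) F0.
have := congr1 (fun p : {poly k} => p`_c) G0.
rewrite !horner_polyC !coef_map !coef0 /= /horner_eval => Gc Fa.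
by have := coprimep_root cop (introT rootP Fa); rewrite Gc eqxx.
Qed.

(** Here [fh] stands for f not vanishing on H, [fv] for f not vanishing on V, [ma] for m <= a, and
    so on. One generator is nonzero on H while the other is nonzero on V. *)
Lemma ruling_cases (fh fv gh gv ma nb mc nd : bool) :
  fh || gh -> fv || gv -> fh || fv -> gh || gv ->
  (fh -> ma) -> (fv -> nb) -> (gh -> mc) -> (gv -> nd) ->
  mc && nb || ma && nd.
Proof.
move=> coh cov nf ng /implyP ifh /implyP ifv /implyP igh /implyP igv.
by case: fh fv gh gv ma nb mc nd coh cov nf ng ifh ifv igh igv => [] [] [] [] [] [] [] [].
Qed.

Local Close Scope ring_scope.

Theorem theorem3p2 (k : closedFieldType) (X : {fset P1 k * P1 k}) (m n : nat)
    (X_nonempty : X != fset0)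
    (hm : is_max (on_horizontal X) m)
    (hn : is_max (on_vertical X) n)
    (card_lt : #|` X| < m * n)
    (meet : exists2 P, P \in X &
              on_horizontal X P.2 = m /\ on_vertical X P.1 = n) :
  ~ virtual_complete_intersection X.
Proof.
move=> [f [g [df [dg [hf [hg [_ iso]]]]]]].
case: meet => P PX [mE nE].
have I0 : vanishing_ideal X 0%R by move=> Q _ u v _ _ _ _; rewrite meval0.
have Ilin p q r : vanishing_ideal X q -> vanishing_ideal X r ->
    vanishing_ideal X (p * q + r)%R.
  move=> Iq Ir Q QX u v uQ nzu vQ nzv.
  by rewrite mevalD mevalM (Iq Q) // (Ir Q) // mulr0 addr0.
have to_gen2 := ideal_to_gen2 I0 Ilin iso.
have of_gen2 := gen2_to_ideal I0 Ilin iso.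
move=> {iso}; have [a [b {}hf]] := bihomog_nat hf; have [c [d {}hg]] := bihomog_nat hg.
have If : vanishing_ideal X f.
  by apply: (gen2_vanishing of_gen2 hf); exists 1%R, 0%R; rewrite mul1r mul0r addr0.
have Ig : vanishing_ideal X g.
  by apply: (gen2_vanishing of_gen2 hg); exists 0%R, 1%R; rewrite mul1r mul0r add0r.
(* The pair (g, f) satisfies the same hypothesis, which gives ad <= |X| and lets g play the role of
   f. *)
have to_gen2' : forall h e r q, irrelevant h -> bihomog e h ->
    bihomog (e *+ r)%R q -> vanishing_ideal X q -> exists s, gen2 g f (h ^+ s * q)%R.
  by move=> h e r q hi he hq /(to_gen2 _ _ _ _ hi he hq)[s /gen2C]; exists s.
have [alpha alphaP] := exists_finite_at [seq Q.1 | Q <- enum_fset X].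
have [beta betaP] := exists_finite_at [seq Q.2 | Q <- enum_fset X].
have fin1 Q : Q \in X -> finite_at alpha Q.1 by move=> QX; apply/alphaP/map_f.
have fin2 Q : Q \in X -> finite_at beta Q.2 by move=> QX; apply/betaP/map_f.
have bc := bidegree_le_card to_gen2 fin1 fin2 hf hg.
have ad := bidegree_le_card to_gen2' fin1 fin2 hg hf.
have coh := coprimep_coef_horner_polyC (coord beta P.2) (coprimep_s to_gen2 beta fin1 hf hg).
have cov : ((swapXY (dehom alpha beta f)).[(coord alpha P.1)%:P] != 0)%R ||
           ((swapXY (dehom alpha beta g)).[(coord alpha P.1)%:P] != 0)%R.
  apply: coprimep_coef_horner_polyC; rewrite !swapXYK.
  exact: (coprimep_t to_gen2 alpha fin2 hf hg).
have PL : (coord alpha P.1, coord beta P.2) \in affine_points X alpha beta.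
  exact: (map_f (fun P => (coord alpha P.1, coord beta P.2))).
have ideal := affine_ideal to_gen2 fin1 fin2.
have ideal' := affine_ideal to_gen2' fin1 fin2.
have notf : ((dehom alpha beta f).[(coord beta P.2)%:P] != 0)%R ||
            ((swapXY (dehom alpha beta f)).[(coord alpha P.1)%:P] != 0)%R.
  rewrite -negb_and; apply/negP => /andP[/eqP fh /eqP fv].
  exact: (not_both_rulings PL (vanishing_dehom fin1 fin2 Ig) ideal fh fv).
have notg : ((dehom alpha beta g).[(coord beta P.2)%:P] != 0)%R ||
            ((swapXY (dehom alpha beta g)).[(coord alpha P.1)%:P] != 0)%R.
  rewrite -negb_and; apply/negP => /andP[/eqP gh /eqP gv].
  exact: (not_both_rulings PL (vanishing_dehom fin1 fin2 If) ideal' gh gv).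
have fh := horizontal_ruling fin1 fin2 hf If (P := P).
have fv := vertical_ruling fin1 fin2 hf If (P := P).
have gh := horizontal_ruling fin1 fin2 hg Ig (P := P).
have gv := vertical_ruling fin1 fin2 hg Ig (P := P).
rewrite mE in fh gh; rewrite nE in fv gv.
suff : (m <= c) && (n <= b) || (m <= a) && (n <= d).
  case/orP => /andP[h1 h2]; move: card_lt; rewrite ltnNge => /negP[].
    by apply: leq_trans bc; rewrite [b * c]mulnC leq_mul.
  by apply: leq_trans ad; rewrite [d * a]mulnC leq_mul.
exact: (ruling_cases coh cov notf notg fh fv gh gv).
Qed.
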